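(* Let $\psi:\mathbb{R}\times\mathbb{R}\to\mathbb{R}$, $(x,\theta)\mapsto\psi(x,\theta)$, be continuous and almost everywhere differentiable, let $\mathbf{x}=(x_1,\dots,x_N)\in\mathbb{R}^N$ be a given data set, let $T_N=T_N(\mathbf{x})$ be the associated $M$-estimate, i.e. the solution of $\sum_{n=1}^N\psi(x_n,T_N)=0$, and let $p\ge1$. Then $$\text{AIF}(\psi,\mathbf{x},p)\ \ge\ \frac{\frac1N\sum_{n=1}^N\left|\frac{\partial\psi}{\partial x}(x_n,T_N)\right|}{\left|\frac1N\sum_{n=1}^N\frac{\partial\psi}{\partial\theta}(x_n,T_N)\right|},$$ and equality holds when $$\left|\frac{\partial\psi}{\partial x}(x_1,T_N)\right|=\cdots=\left|\frac{\partial\psi}{\partial x}(x_N,T_N)\right|.$$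
   Context: $M$-estimator: for a data set $\mathbf{y}=(y_1,\dots,y_N)\in\mathbb{R}^N$, the estimate $T_N(\mathbf{y})\in\mathbb{R}$ is the solution $t$ of $\sum_{n=1}^N\psi(y_n,t)=0$; it is understood that $T_N$ is well defined by this equation (for each data set the equation has exactly one solution). Adversarial influence function (AIF): for $\eta>0$ and real $p\ge1$ let $\Delta T_N(\mathbf{x})$ be the optimal value (supremum) of $$\max_{\Delta\mathbf{x}\in\mathbb{R}^N}\ |T_N(\mathbf{x}+\Delta\mathbf{x})-T_N(\mathbf{x})|\quad\text{subject to}\quad \frac1N\|\Delta\mathbf{x}\|_p^p\le\eta^p,$$ where $\|\Delta\mathbf{x}\|_p^p=\sum_{n=1}^N|\Delta x_n|^p$. Then $$\text{AIF}(T_N,\mathbf{x},p)=\lim_{\eta\downarrow0}\frac{\Delta T_N(\mathbf{x})}{\eta},$$ and for the $M$-estimator defined by $\psi$ this is written $\text{AIF}(\psi,\mathbf{x},p)$. For the formulas to be meaningful, $\psi$ is understood to be differentiable at the points $(x_n,T_N)$, $n=1,\dots,N$, and $\sum_{n=1}^N\frac{\partial\psi}{\partial\theta}(x_n,T_N)\neq0$. *)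

(* Defs.v *)
From mathcomp Require Import all_boot all_order all_algebra.
From mathcomp Require Import all_classical all_reals all_analysis.
Set Implicit Arguments.
Unset Strict Implicit.
Unset Printing Implicit Defensive.
Import Order.TTheory GRing.Theory Num.Theory.
Import numFieldNormedType.Exports.
Local Open Scope classical_set_scope.
Local Open Scope ring_scope.

(* A data set y_1, ..., y_N is a row vector. *)
Definition M_equation (R : realType) (N : nat) (psi : R * R -> R)
    (y : 'rV[R]_N) (t : R) : Prop :=
  \sum_(n < N) psi (y 0 n, t) = 0.

Definition M_well_defined (R : realType) (N : nat) (psi : R * R -> R) : Prop :=
  forall y : 'rV[R]_N, exists! t : R, M_equation psi y t.

(* [get] picks a solution; it is the only one under [M_well_defined]. *)
Definition M_estimate (R : realType) (N : nat) (psi : R * R -> R)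
    (y : 'rV[R]_N) : R :=
  get [set t : R | M_equation psi y t].

Definition admissible (R : realType) (N : nat) (p eta : R) : set 'rV[R]_N :=
  [set d : 'rV[R]_N | N%:R^-1 * \sum_(n < N) `|d 0 n| `^ p <= eta `^ p].

(* The supremum is taken in the extended reals, as it may be infinite. *)
Definition max_deviation (R : realType) (N : nat) (T : 'rV[R]_N -> R)
    (x : 'rV[R]_N) (p eta : R) : \bar R :=
  ereal_sup [set (`|T (x + d) - T x|)%:E | d in admissible p eta].

Definition AIF_quotient (R : realType) (N : nat) (T : 'rV[R]_N -> R)
    (x : 'rV[R]_N) (p eta : R) : \bar R :=
  (max_deviation T x p eta * (eta^-1)%:E)%E.

(* [lim] is a default value unless the quotient converges, which is [AIF_exists]. *)
Definition AIF_exists (R : realType) (N : nat) (T : 'rV[R]_N -> R)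
    (x : 'rV[R]_N) (p : R) : Prop :=
  cvg (AIF_quotient T x p eta @[eta --> 0^'+]).

Definition AIF (R : realType) (N : nat) (T : 'rV[R]_N -> R)
    (x : 'rV[R]_N) (p : R) : \bar R :=
  lim (AIF_quotient T x p eta @[eta --> 0^'+]).

Definition partial_x (R : realType) (psi : R * R -> R) (z : R * R) : R :=
  (fun u : R => psi (u, z.2))^`()%classic z.1.

Definition partial_theta (R : realType) (psi : R * R -> R) (z : R * R) : R :=
  (fun t : R => psi (z.1, t))^`()%classic z.2.

(* Frechet differentiability; a.e. for the two-dimensional Lebesgue measure. *)
Definition ae_differentiable (R : realType) (psi : R * R -> R) : Prop :=
  {ae (@lebesgue_measure R \x @lebesgue_measure R)%E,
    forall z, differentiable psi z}.

(* Main.v *)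
Require Import Defs.
From mathcomp Require Import all_boot all_order all_algebra.
From mathcomp Require Import all_classical all_reals all_analysis.
From mathcomp Require Import ring lra.
Set Implicit Arguments.
Unset Strict Implicit.
Unset Printing Implicit Defensive.
Import Order.TTheory GRing.Theory Num.Theory.
Import numFieldNormedType.Exports.
Local Open Scope classical_set_scope.
Local Open Scope ring_scope.

(** Write T for the estimate at x, a_n and b_n for the partial derivatives of
    psi in its first and second variable at (x_n, T), and S for the sum of the
    b_n. The equation sum_n psi(y_n, t) = 0 has its root at T when y = x, and
    differentiability at the N points (x_n, T) gives, for small d and h,
<<
      sum_n psi(x_n + d_n, T + h) = sum_n a_n d_n + S h + o(|d| + |h|).
>>
    With L(d) = - sum_n (a_n / S) d_n, the right-hand side has opposite signs at
    h = L(d) + e |d| and h = L(d) - e |d| as soon as d is small, so continuity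
    puts a root between them; the root is unique, so it is the estimate at
    x + d. Hence the estimator is Frechet differentiable at x with derivative
    L ([M_estimate_linear_expansion]). Since the root is
    unique on the whole line, only its location has to be controlled, and for
    that differentiability of psi at the N points (x_n, T) suffices.

    The perturbations allowed at level eta are eta times those allowed at level
    1, and the latter are bounded. So the expansion holds uniformly over them,
    and the quotient converges to the maximum of |L(k)| over the k with
    (1/N) sum_n |k_n|^p <= 1 ([AIF_quotient_cvg]).

    It remains to estimate that maximum. The vector of signs of the coefficients
    of L is allowed for every p, and gives sum_n |a_n / S|, which is the claimed
    bound ([sum_norm_le_response_norm]). If all |a_n| are equal, then |L(k)| is
    at most |a_1 / S| sum_n |k_n|, and the power mean inequality bounds
    sum_n |k_n| by N ([admissible_norm1_le]), so the maximum is no larger. *)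

(** * Expansion of the estimate under a small perturbation of the data *)

Lemma differentiable_partial_expansion (R : realType) (psi : R * R -> R)
    (z : R * R) (e : R) :
  differentiable psi z -> 0 < e ->
  \forall rho \near 0^'+, forall u v : R, `|u| <= rho -> `|v| <= rho ->
    `|psi (z.1 + u, z.2 + v)
      - (psi z + partial_x psi z * u + partial_theta psi z * v)|
    <= e * Num.max `|u| `|v|.
Proof.
move=> dpsi e_gt0.
have px : partial_x psi z = 'd psi z (1, 0).
  rewrite -deriveE // /partial_x /derive1 /derive.
  apply: (congr1 (fun g : R -> R => lim (g h @[h --> 0^']))).
  apply/funext => h; congr (_ *: (psi (_, _) - psi _)) => /=;
    by rewrite ?[_ *: 1]mulr1 ?[_ *: 0]mulr0 ?add0r //; case: (z).
have pt : partial_theta psi z = 'd psi z (0, 1).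
  rewrite -deriveE // /partial_theta /derive1 /derive.
  apply: (congr1 (fun g : R -> R => lim (g h @[h --> 0^']))).
  apply/funext => h; congr (_ *: (psi (_, _) - psi _)) => /=;
    by rewrite ?[_ *: 1]mulr1 ?[_ *: 0]mulr0 ?add0r //; case: (z).
have lin u v : 'd psi z (u, v) = partial_x psi z * u + partial_theta psi z * v.
  have -> : (u, v) = u *: (1, 0) + v *: (0, 1) :> R * R.
    by congr (_, _); rewrite /= ?scaler0 ?addr0 ?add0r [_ *: 1]mulr1.
  by rewrite linearD !linearZ /= px pt ![_ *: 'd _ _ _]mulrC.
have /eqaddoP/(_ _ e_gt0) := diff_locally dpsi.
move=> /nbhs_ballP[d /= d_gt0 near_le].
near=> rho => u v u_le v_le.
have /= := near_le (u, v).
rewrite /= !fctE lin addrA /= => H.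
have -> : (z.1 + u, z.2 + v) = (u, v) + z by congr (_, _); exact: addrC.
apply: H; rewrite -ball_normE /= sub0r normrN.
have rho_lt : rho < d by near: rho; exact: nbhs_right_lt.
by rewrite gt_max /= (le_lt_trans u_le) // (le_lt_trans v_le).
Unshelve. all: by end_near. Qed.

(** Frechet differentiability of T at x with gradient c. It is phrased with an
    explicit radius r bounding the entries of d, rather than with the norm of d,
    because the perturbations it is applied to are controlled only through such
    a common bound. *)
Definition linear_expansion (R : realType) (N : nat) (T : 'rV[R]_N -> R)
    (x : 'rV[R]_N) (c : 'I_N -> R) : Prop :=
  forall e, 0 < e -> exists2 delta, 0 < delta &
    forall (r : R) (d : 'rV[R]_N), 0 < r < delta -> (forall n, `|d 0 n| <= r) ->
      `|T (x + d) - T x - \sum_(n < N) c n * d 0 n| <= e * r.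

Section MEstimate.
Variables (R : realType) (N : nat) (psi : R * R -> R).
Hypothesis psi_cont : continuous psi.
Hypothesis T_def : M_well_defined N psi.

Lemma M_estimateP (y : 'rV[R]_N) : M_equation psi y (M_estimate psi y).
Proof. by apply: getPex; have [t [yt _]] := T_def y; exists t. Qed.

Lemma M_estimate_unique (y : 'rV[R]_N) (t : R) :
  M_equation psi y t -> M_estimate psi y = t.
Proof.
move=> yt; have [s [_ s_uniq]] := T_def y.
by rewrite -(s_uniq _ yt) -(s_uniq _ (M_estimateP y)).
Qed.

(** The intermediate value theorem produces a root between s and t, and
    uniqueness of the root identifies it with the estimate. *)
Lemma M_estimate_between (y : 'rV[R]_N) (s t : R) : s <= t ->
  (\sum_(n < N) psi (y 0 n, s)) * (\sum_(n < N) psi (y 0 n, t)) <= 0 ->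
  s <= M_estimate psi y <= t.
Proof.
set f := fun t => \sum_(n < N) psi (y 0 n, t) => st.
rewrite -/(f s) -/(f t) => sgn.
have f_cont : continuous f.
  move=> u; apply: (cvg_big (@add_continuous R^o)) => n _.
  apply: (@continuous_comp _ _ _ (fun t : R => (y 0 n, t)) psi).
    rewrite /continuous_at.
    by apply: (@cvg_pair _ _ _ _ (nbhs (y 0 n)) (nbhs u));
      [exact: cvg_cst|exact: cvg_id].
  exact: psi_cont.
have [||v] := @IVT R f s t 0 st.
- exact: continuous_subspaceT.
- rewrite ge_min le_max.
  have [fs|fs] := leP (f s) 0; have [ft|ft] := leP 0 (f t) => //=; nra.
by rewrite in_itv /= => v_in /M_estimate_unique ->.
Qed.

Variable x : 'rV[R]_N.
Let T := M_estimate psi x.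
Let a n := partial_x psi (x 0 n, T).
Let S := \sum_(n < N) partial_theta psi (x 0 n, T).

(** The left-hand sides of the estimating equation at T + L(d) + e r and
    T + L(d) - e r have dominant terms S e r and - S e r, so they differ in sign
    once the remainder is below |S| e r. *)
Lemma M_estimate_linear_expansion :
  (forall n, differentiable psi (x 0 n, T)) -> S != 0 ->
  linear_expansion (M_estimate psi) x (fun n => - (a n / S)).
Proof.
move=> dpsi S_neq0 e e_gt0.
have S_gt0 : 0 < `|S| by rewrite normr_gt0.
set A := \sum_(n < N) `|a n| / `|S|.
have A_ge0 : 0 <= A by apply: sumr_ge0 => n _; rewrite divr_ge0.
(* D r bounds the entries of d, which are at most r, and also the shifts
   L(d) + e r and L(d) - e r of the estimate, which are at most A r + e r. *)
pose D := 1 + A + e.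
have D_gt0 : 0 < D by rewrite /D; lra.
(* Each of the N remainders is at most e' D r, so their sum is below |S| e r;
   N.+1 in place of N keeps the denominator nonzero. *)
pose e' := `|S| * e / (N.+1%:R * D).
have e'_gt0 : 0 < e' by rewrite divr_gt0 ?mulr_gt0.
have near_expansion : \forall rho \near 0^'+, forall (n : 'I_N) (u v : R),
    `|u| <= rho -> `|v| <= rho ->
    `|psi (x 0 n + u, T + v) - (psi (x 0 n, T) + a n * u
        + partial_theta psi (x 0 n, T) * v)| <= e' * Num.max `|u| `|v|.
  by apply: filter_forall => n; exact: differentiable_partial_expansion.
have [rho [expansion rho_gt0]] :=
  filter_ex (filterI near_expansion (nbhs_right_gt (0 : R))).
exists (rho / D); first exact: divr_gt0.
move=> r d /andP[r_gt0]; rewrite ltr_pdivlMr // => r_lt d_le.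
set L := \sum_(n < N) _.
have L_le : `|L| <= A * r.
  rewrite (le_trans (ler_norm_sum _ _ _)) // mulr_suml ler_sum // => n _.
  by rewrite normrM normrN normrM normfV ler_wpM2l // divr_ge0.
have SL : S * L = - \sum_(n < N) a n * d 0 n.
  rewrite mulr_sumr -sumrN; apply: eq_bigr => n _; field.
  exact: S_neq0.
have Tzero : \sum_(n < N) psi (x 0 n, T) = 0 by exact: M_estimateP.
have sum_expansion h : `|h| <= D * r ->
    `|\sum_(n < N) psi ((x + d) 0 n, T + h) - S * (h - L)| <= `|S| * e * r.
  move=> h_le.
  have -> : \sum_(n < N) psi ((x + d) 0 n, T + h) - S * (h - L) =
      \sum_(n < N) (psi (x 0 n + d 0 n, T + h) - (psi (x 0 n, T)
        + a n * d 0 n + partial_theta psi (x 0 n, T) * h)).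
    rewrite sumrB !big_split /= Tzero -mulr_suml mulrBr SL add0r opprK.
    rewrite [S * h + _]addrC.
    by congr (_ - _); apply: eq_bigr => n _; rewrite mxE.
  rewrite (le_trans (ler_norm_sum _ _ _)) //.
  have r_le : r <= D * r by rewrite ler_peMl ?ltW // /D; lra.
  apply: (@le_trans _ _ (\sum_(n < N) e' * (D * r))).
    apply: ler_sum => n _; apply: (le_trans (expansion n _ _ _ _)).
    - by rewrite (le_trans (d_le n)) // (le_trans r_le) // mulrC ltW.
    - by rewrite (le_trans h_le) // mulrC ltW.
    - by rewrite ler_wpM2l ?(ltW e'_gt0) // ge_max h_le (le_trans (d_le n)).
  rewrite sumr_const card_ord -mulr_natl /e'.
  have -> : N%:R * (`|S| * e / (N.+1%:R * D) * (D * r)) =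
      N%:R / N.+1%:R * (`|S| * e * r).
    by field; rewrite !lt0r_neq0.
  rewrite ler_piMl ?mulr_ge0 ?ltW //.
  by rewrite ltr_pdivrMr // mul1r ltr_nat.
have T_in : T + (L - e * r) <= M_estimate psi (x + d) <= T + (L + e * r).
  have er_gt0 : 0 < e * r by exact: mulr_gt0.
  have hD h : `|h - L| = e * r -> `|h| <= D * r.
    move=> hL; rewrite -[h](subrK L) (le_trans (ler_normD _ _)) // hL /D.
    by rewrite !mulrDl mul1r; lra.
  apply: M_estimate_between; first by lra.
  have := sum_expansion (L + e * r).
  have -> : L + e * r - L = e * r by ring.
  have /[swap]/[apply] : `|L + e * r| <= D * r.
    by apply: hD; rewrite addrAC subrr add0r gtr0_norm.
  have := sum_expansion (L - e * r).
  have -> : L - e * r - L = - (e * r) by ring.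
  have /[swap]/[apply] : `|L - e * r| <= D * r.
    by apply: hD; rewrite addrAC subrr add0r normrN gtr0_norm.
  rewrite -mulrA.
  have [S_ge0|S_lt0] := leP 0 S.
    rewrite (ger0_norm S_ge0) !ler_norml => /andP[_ lo] /andP[hi _].
    by rewrite mulr_le0_ge0 //; lra.
  rewrite (ltr0_norm S_lt0) !ler_norml => /andP[lo _] /andP[_ hi].
  by rewrite mulr_ge0_le0 //; lra.
by move/andP: T_in => [lo hi]; rewrite -/T ler_norml; lra.
Qed.

End MEstimate.

(** * The largest linear response to an admissible perturbation *)

(** Bernoulli's inequality (1 + h)^p >= 1 + p h at 1 + h = u. For p > 1 it is
    Young's inequality for the product u * 1. *)
Lemma bernoulli_powR (R : realType) (u p : R) :
  0 <= u -> 1 <= p -> p * u <= u `^ p + (p - 1).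
Proof.
move=> u_ge0; rewrite le_eqVlt => /predU1P[<-|p_gt1].
  by rewrite powRr1 // mul1r; lra.
have p_gt0 : 0 < p by lra.
have q_gt0 : 0 < (1 - p^-1)^-1 by rewrite invr_gt0 subr_gt0 invf_lt1.
have := conjugate_powR u_ge0 ler01 p_gt0 q_gt0.
rewrite invrK powR1 mul1r mulr1 => /(_ (subrKC _ _)).
move=> /(ler_wpM2l (ltW p_gt0)) /le_trans; apply.
by rewrite le_eqVlt; apply/orP; left; apply/eqP; field; lra.
Qed.

Lemma admissibleZ (R : realType) (N : nat) (p eta : R) (k : 'rV[R]_N) :
  0 < eta -> admissible p eta (eta *: k) <-> admissible p 1 k.
Proof.
move=> eta_gt0; rewrite /admissible /= powR1.
have -> : \sum_(n < N) `|(eta *: k) 0 n| `^ p =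
    eta `^ p * \sum_(n < N) `|k 0 n| `^ p.
  rewrite mulr_sumr; apply: eq_bigr => n _.
  by rewrite mxE normrM gtr0_norm // powRM // ltW.
by rewrite mulrCA ger_pMr // powR_gt0.
Qed.

Lemma admissible0 (R : realType) (N : nat) (p : R) : 1 <= p ->
  admissible p 1 (0 : 'rV[R]_N).
Proof.
move=> p_ge1; rewrite /admissible /= powR1 big1 ?mulr0 // => n _.
by rewrite mxE normr0 powR0 // gt_eqF //; lra.
Qed.

(** The power mean inequality: averaging p |k_n| <= |k_n|^p + (p - 1) gives
    p mean |k| <= 1 + (p - 1) = p. *)
Lemma admissible_norm1_le (R : realType) (N : nat) (p : R) (k : 'rV[R]_N) :
  1 <= p -> admissible p 1 k -> \sum_(n < N) `|k 0 n| <= N%:R.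
Proof.
case: N k => [k _ _|N k p_ge1]; first by rewrite big_ord0.
rewrite /admissible /= powR1 mulrC ler_pdivrMr // mul1r => k_adm.
have : \sum_(n < N.+1) p * `|k 0 n| <=
    \sum_(n < N.+1) (`|k 0 n| `^ p + (p - 1)).
  by apply: ler_sum => n _; exact: bernoulli_powR.
rewrite -mulr_sumr big_split sumr_const card_ord /= -[(p - 1) *+ _]mulr_natl.
set s := \sum_(n < N.+1) `|k 0 n|; set M := _.+1%:R => H.
have : p * s <= p * M by move: k_adm H; rewrite -/M; lra.
by rewrite ler_pM2l //; lra.
Qed.

(** Up to the factor N^(1/p), the norm of c dual to the p-norm. It is left as a
    supremum, so that p = 1, whose dual exponent is infinite, needs no separate
    treatment. *)
Definition response_norm (R : realType) (N : nat) (p : R) (c : 'I_N -> R) : R :=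
  sup [set `|\sum_(n < N) c n * k 0 n| | k in admissible p 1].

Section Response.
Variables (R : realType) (N : nat) (p : R) (c : 'I_N -> R).
Hypothesis p_ge1 : 1 <= p.

Lemma admissible_entry_le (k : 'rV[R]_N) n :
  admissible p 1 k -> `|k 0 n| <= N%:R.
Proof.
move=> /(admissible_norm1_le p_ge1); apply: le_trans.
by rewrite (bigD1 n) //= lerDl sumr_ge0.
Qed.

Lemma response_norm_ge (k : 'rV[R]_N) : admissible p 1 k ->
  `|\sum_(n < N) c n * k 0 n| <= response_norm p c.
Proof.
move=> k_adm; apply: ub_le_sup; last by exists k.
exists (\sum_(n < N) `|c n| * N%:R) => _ [l l_adm <-].
rewrite (le_trans (ler_norm_sum _ _ _)) // ler_sum // => n _.
by rewrite normrM ler_wpM2l // admissible_entry_le.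
Qed.

Lemma response_norm_le (b : R) :
  (forall k : 'rV[R]_N, admissible p 1 k ->
     `|\sum_(n < N) c n * k 0 n| <= b) ->
  response_norm p c <= b.
Proof.
move=> le_b; apply: ge_sup; last by move=> _ [k k_adm <-]; exact: le_b.
exists `|\sum_(n < N) c n * (0 : 'rV[R]_N) 0 n|; exists 0 => //.
exact: admissible0.
Qed.

(** Attained at the signs of c: such a k has all |k_n|^p = 1, hence is admissible
    whatever p is. *)
Lemma sum_norm_le_response_norm : \sum_(n < N) `|c n| <= response_norm p c.
Proof.
(* Zero coefficients get the sign 1, so that every entry has absolute value 1. *)
pose k : 'rV[R]_N := \row_n (if 0 <= c n then 1 else -1).
have normk n : `|k 0 n| = 1 by rewrite mxE; case: ifP; rewrite ?normrN normr1.
have -> : \sum_(n < N) `|c n| = `|\sum_(n < N) c n * k 0 n|.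
  rewrite ger0_norm; last first.
    by apply: sumr_ge0 => n _; rewrite mxE; have [?|?] := leP 0 (c n); lra.
  apply: eq_bigr => n _; rewrite mxE.
  by have [c_ge0|c_lt0] := leP 0 (c n);
    rewrite ?(ger0_norm c_ge0) ?(ltr0_norm c_lt0) ?mulr1 ?mulrN1.
apply: response_norm_ge; rewrite /admissible /= powR1.
rewrite (eq_bigr (fun=> 1)) => [|n _]; last by rewrite normk powR1.
rewrite sumr_const card_ord; case: (N) => [|m]; first by rewrite mulr0.
by rewrite mulVf.
Qed.

(** With equal weights the response is controlled by the 1-norm of k alone, and
    the power mean inequality shows that the vector of signs is optimal. *)
Lemma response_norm_const :
  (forall m n, `|c m| = `|c n|) -> response_norm p c = \sum_(n < N) `|c n|.
Proof.
move=> eqc; apply/eqP; rewrite eq_le sum_norm_le_response_norm andbT.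
apply: response_norm_le => k k_adm.
rewrite (le_trans (ler_norm_sum _ _ _)) //.
have [n0|/forallNP noord] := pselect (exists n : 'I_N, True); last first.
  by rewrite !big1 // => n; case: (noord n).
case: n0 => n0 _.
rewrite (eq_bigr (fun n => `|c n0| * `|k 0 n|)) => [|n _]; last first.
  by rewrite normrM (eqc n n0).
rewrite [leRHS](eq_bigr (fun=> `|c n0|)) => [|n _]; last exact: eqc.
rewrite -mulr_sumr sumr_const card_ord -[leRHS]mulr_natr.
by rewrite ler_wpM2l // (admissible_norm1_le p_ge1).
Qed.

(** Substituting d = eta k turns the quotient into the supremum over a fixed set
    of |T (x + eta k) - T x| / eta, which is within e of |c . k| uniformly in k;
    suprema of uniformly close functions are close. *)
Lemma AIF_quotient_cvg (T : 'rV[R]_N -> R) (x : 'rV[R]_N) :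
  linear_expansion T x c ->
  AIF_quotient T x p eta @[eta --> 0^'+] --> (response_norm p c)%:E.
Proof.
move=> Tlin; set M := response_norm p c.
have bounds e : 0 < e -> \forall eta \near 0^'+,
    ((M - e)%:E <= AIF_quotient T x p eta <= (M + e)%:E)%E.
  move=> e_gt0.
  (* The entries of eta k are below eta (N + 1), which serves as the radius. *)
  have [|delta delta_gt0 Tdelta] := Tlin (e / N.+1%:R); first exact: divr_gt0.
  near=> eta.
  have eta_gt0 : 0 < eta by near: eta; exact: nbhs_right_gt.
  have eta_lt : eta * N.+1%:R < delta.
    rewrite -ltr_pdivlMr //; near: eta.
    by apply: nbhs_right_lt; exact: divr_gt0.
  have resp (k : 'rV[R]_N) : admissible p 1 k ->
      `|T (x + eta *: k) - T x - eta * \sum_(n < N) c n * k 0 n| <= e * eta.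
    move=> k_adm; have := Tdelta (eta * N.+1%:R) (eta *: k).
    have -> : \sum_(n < N) c n * (eta *: k) 0 n = eta * \sum_(n < N) c n * k 0 n.
      by rewrite mulr_sumr; apply: eq_bigr => n _; rewrite mxE mulrCA.
    have -> : e / N.+1%:R * (eta * N.+1%:R) = e * eta.
      by field; rewrite lt0r_neq0.
    apply; first by rewrite mulr_gt0.
    move=> n; rewrite mxE normrM gtr0_norm // ler_wpM2l ?ltW //.
    by rewrite (le_lt_trans (admissible_entry_le n k_adm)) // ltr_nat.
  rewrite /AIF_quotient lee_pdivlMr // lee_pdivrMr //; apply/andP; split.
  - have -> : ((M - e)%:E * eta%:E = (eta * M - e * eta)%:E)%E.
      by rewrite -EFinM; congr (_%:E); ring.
    have dev_ge k : admissible p 1 k ->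
        (`|T (x + eta *: k) - T x|%:E <= max_deviation T x p eta)%E.
      move=> k_adm; apply: ereal_sup_ubound; exists (eta *: k) => //.
      exact/admissibleZ.
    case: (max_deviation _ _ _ _) dev_ge => [q| |] dev_ge; last 1 first.
    + by have := dev_ge _ (admissible0 _ p_ge1).
    + rewrite lee_fin lerBlDr mulrC -ler_pdivlMr //.
      apply: response_norm_le => k k_adm; rewrite ler_pdivlMr //.
      have := dev_ge _ k_adm; rewrite lee_fin => q_ge.
      have := ler_normB (T (x + eta *: k) - T x)
        (T (x + eta *: k) - T x - eta * \sum_(n < N) c n * k 0 n).
      rewrite opprB addrC subrK normrM gtr0_norm // [_ * eta]mulrC.
      by have := resp k k_adm; lra.
    + exact: leey.
  - apply: ge_ereal_sup => _ [d d_adm <-]; rewrite -EFinM lee_fin.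
    pose k := eta^-1 *: d.
    have dE : d = eta *: k by rewrite scalerA divff ?scale1r // gt_eqF.
    move: d_adm; rewrite dE => /(admissibleZ _ _ eta_gt0) k_adm.
    have := ler_normD (T (x + eta *: k) - T x - eta * \sum_(n < N) c n * k 0 n)
      (eta * \sum_(n < N) c n * k 0 n).
    rewrite subrK => /le_trans; apply.
    rewrite mulrDl addrC lerD // ?resp // normrM gtr0_norm // mulrC.
    by apply: ler_wpM2r; [exact: ltW|exact: response_norm_ge].
apply/fine_cvgP; split.
  near=> eta.
  have /andP[lo hi] : ((M - 1)%:E <= AIF_quotient T x p eta <= (M + 1)%:E)%E.
    by near: eta; exact: bounds.
  by rewrite fin_numElt (lt_le_trans _ lo) ?ltNyr // (le_lt_trans hi) ?ltry.
apply/cvgrPdist_le => e e_gt0; near=> eta.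
have : ((M - e)%:E <= AIF_quotient T x p eta <= (M + e)%:E)%E.
  by near: eta; exact: bounds.
rewrite /=; case: (AIF_quotient _ _ _ _) => [q| |] /=; last 2 first.
- by rewrite leye_eq andbF.
- by [].
by rewrite !lee_fin ler_norml => /andP[]; lra.
Unshelve. all: by end_near. Qed.

End Response.

(** * The influence of an adversarial perturbation *)

Theorem corollary1 (R : realType) (N : nat) (psi : R * R -> R)
    (x : 'rV[R]_N) (p : R)
    (psi_cont : continuous psi)
    (psi_ae : ae_differentiable psi)
    (T_def : M_well_defined N psi)
    (psi_diff : forall n : 'I_N,
       differentiable psi (x 0 n, M_estimate psi x))
    (dtheta_neq0 :
       \sum_(n < N) partial_theta psi (x 0 n, M_estimate psi x) != 0)
    (p_ge1 : 1 <= p) :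
  let T := M_estimate psi x in
  let bound :=
    (N%:R^-1 * \sum_(n < N) `|partial_x psi (x 0 n, T)|) /
    `|N%:R^-1 * \sum_(n < N) partial_theta psi (x 0 n, T)| in
  [/\ AIF_exists (M_estimate psi) x p,
      (bound%:E <= AIF (M_estimate psi) x p)%E
    & (forall m n : 'I_N,
         `|partial_x psi (x 0 m, T)| = `|partial_x psi (x 0 n, T)|) ->
      AIF (M_estimate psi) x p = bound%:E].
Proof.
move=> T bound.
pose c n := - (partial_x psi (x 0 n, T)
  / \sum_(m < N) partial_theta psi (x 0 m, T)).
have quotient_cvg : AIF_quotient (M_estimate psi) x p eta @[eta --> 0^'+]
    --> (response_norm p c)%:E.
  by apply: AIF_quotient_cvg => //; exact: M_estimate_linear_expansion.
have AIFE : AIF (M_estimate psi) x p = (response_norm p c)%:E.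
  exact: cvg_lim quotient_cvg.
have N_gt0 : (0 < N)%N.
  case: (N) x dtheta_neq0 {psi_diff T_def T bound c quotient_cvg AIFE} => //.
  by move=> y; rewrite big_ord0 eqxx.
have boundE : bound = \sum_(n < N) `|c n|.
  rewrite /bound normrM normfV normr_nat -mulf_div divff ?mul1r; last first.
    by rewrite invr_eq0 pnatr_eq0 -lt0n.
  by rewrite mulr_suml; apply: eq_bigr => n _; rewrite normrN normrM normfV.
split.
- by apply/cvg_ex; exists (response_norm p c)%:E.
- by rewrite AIFE lee_fin boundE sum_norm_le_response_norm.
- move=> eq_dx; rewrite AIFE boundE response_norm_const // => m n.
  by rewrite !normrN !normrM (eq_dx m n).
Qed.
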